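(* Let $A\in\mathbb{Z}^{m\times n}$ with $\operatorname{rank}(A)=m$ and $b\in\mathbb{Z}^m$, and let $(F)$ be the system $Ax=b,\ x\in\mathbb{Z}^n_+$. Assume that the cone $\mathcal{C}(A)$ is pointed. Let $T\in\mathbb{Q}^{1\times m}$ be a strong aggregation matrix of size one for $(F)$, scaled so that $\alpha:=TA$ is an integer vector and $\beta:=Tb$ is an integer, and such that $\alpha_j>0$ for all $j=1,\dots,n$; thus the aggregated equation is $\sum_{i=1}^n\alpha_i x_i=\beta$. Then the number $\sigma_\beta$ of solutions of $(F)$ is $$\sigma_\beta=\frac{2^{\beta-1}}{\pi}\int_{-\pi}^{\pi}\left(\prod_{j=1}^n\frac{2^{\alpha_j}}{2^{\alpha_j}-e^{\imath\alpha_j\theta}}\right)e^{-\imath\beta\theta}\,d\theta .$$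
   Context: $\imath$ is the imaginary unit and $\mathbb{Z}_+$ denotes the non-negative integers. $\mathcal{C}(A)=\{Ax\mid x\in\mathbb{R}^n,\ x\ge 0\}$; it is pointed if $\mathcal{C}(A)\cap(-\mathcal{C}(A))=\{0\}$. For $T\in\mathbb{Q}^{1\times m}$, the aggregated system $(F_T)$ is $TAx=Tb,\ x\in\mathbb{Z}^n_+$; $T$ is a strong aggregation matrix for $(F)$ if $(F)$ and $(F_T)$ have the same set of solutions. *)

(* Defs.v *)
From HB Require Import structures.
From mathcomp Require Import all_boot all_order all_algebra.
From mathcomp Require Import all_classical all_reals all_analysis.
From mathcomp Require Import complex.

Set Implicit Arguments.
Unset Strict Implicit.
Unset Printing Implicit Defensive.

Import Order.TTheory GRing.Theory Num.Theory.
Import numFieldNormedType.Exports.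

Local Open Scope classical_set_scope.
Local Open Scope ring_scope.
Local Open Scope complex_scope.

Definition solutions (m n : nat) (A : 'M[int]_(m, n)) (b : 'cV[int]_m) :
    set 'cV[int]_n :=
  [set x : 'cV[int]_n | (forall j, 0 <= x j 0) /\ A *m x = b].

Definition aggregated_solutions (m n : nat) (T : 'rV[rat]_m)
    (A : 'M[int]_(m, n)) (b : 'cV[int]_m) : set 'cV[int]_n :=
  [set x : 'cV[int]_n | (forall j, 0 <= x j 0) /\
           T *m map_mx intr A *m map_mx intr x = T *m map_mx intr b].

Definition strong_aggregation (m n : nat) (T : 'rV[rat]_m)
    (A : 'M[int]_(m, n)) (b : 'cV[int]_m) : Prop :=
  solutions A b = aggregated_solutions T A b.

Definition cone (R : realType) (m n : nat) (A : 'M[int]_(m, n)) :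
    set 'cV[R]_m :=
  [set map_mx intr A *m x | x in [set x : 'cV[R]_n | forall j, 0 <= x j 0]].
Arguments cone R {m n} A.

Definition pointed (R : realType) (m : nat) (C : set 'cV[R]_m) : Prop :=
  C `&` [set - y | y in C] = [set 0].

Definition cexp (R : realType) (z : R[i]) : R[i] :=
  (expR (complex.Re z))%:C *
  (cos (complex.Im z) +i* sin (complex.Im z)).

(* Lebesgue integral over [a, b] of a complex-valued function, computed on
   the real and imaginary parts. *)
Definition cintegral (R : realType) (a b : R) (f : R -> R[i]) : R[i] :=
  (\int[lebesgue_measure]_(t in `[a, b]) complex.Re (f t)) +i*
  (\int[lebesgue_measure]_(t in `[a, b]) complex.Im (f t)).

(* Main.v *)
Require Import Defs.
From HB Require Import structures.
From mathcomp Require Import all_boot all_order all_algebra.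
From mathcomp Require Import finmap.
From mathcomp Require Import all_classical all_reals all_analysis.
From mathcomp Require Import complex.
From mathcomp Require Import ring zify.

Set Implicit Arguments.
Unset Strict Implicit.
Unset Printing Implicit Defensive.

Import Order.TTheory GRing.Theory Num.Theory.
Import numFieldNormedType.Exports.

Local Open Scope classical_set_scope.
Local Open Scope ring_scope.
Local Open Scope complex_scope.

(** Strong aggregation replaces the system by the single equation
    sum_j alpha_j x_j = beta over x >= 0, so the task is to count the solutions
    of one knapsack equation with positive coefficients.  The generating
    function of these counts is F(z) = prod_j 1 / (1 - z^alpha_j), and the
    integral is Cauchy's formula for its coefficient of z^beta on the circle of
    radius 1/2: with z = e^(i theta) / 2 the factor 2^alpha_j /
    (2^alpha_j - e^(i alpha_j theta)) is 1 / (1 - z^alpha_j).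

    Instead of integrating the power series of F term by term, each geometric
    series is cut after the power N.  The resulting finite product G_N expands
    into a sum over the functions f from the indices j to {0, ..., N}, whose
    terms are multiples of e^(i (sum_j alpha_j f_j - beta) theta).
    Orthogonality of these characters on [- pi, pi] makes the integral of
    G_N e^(- i beta theta) equal to 2 pi 2^(- beta) times the number of f with
    sum_j alpha_j f_j = beta ([cintegral_truncated]).  Since alpha_j >= 1, no
    entry of a solution exceeds beta, so this is the full number of solutions
    once N >= |beta| ([card_knapsack_solutions]).

    On the other hand G_N = F prod_j (1 - z^(alpha_j (N + 1))) differs from F
    by at most a constant times 2^(- N), uniformly in theta
    ([norm_full_sub_truncated_le]).  The integral of F e^(- i beta theta) thus
    differs from a quantity independent of N by an arbitrarily small error,
    hence equals it ([cintegral_full]). *)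

(** * Characters of the unit circle *)

Section CircleCharacter.
Variable R : realType.
Implicit Types (k l : int) (t : R).

Definition circle_char k t : R[i] := cos (k%:~R * t) +i* sin (k%:~R * t).

Lemma cexp_circle_char k t :
  cexp ('i%C * k%:~R * t%:C) = circle_char k t.
Proof.
have -> : (k%:~R : R[i]) = (k%:~R : R)%:C by rewrite rmorph_int.
rewrite /cexp /circle_char.
have -> : 'i%C * (k%:~R : R)%:C * t%:C = 0 +i* (k%:~R * t).
  by apply/eqP; rewrite eq_complex /=; apply/andP; split; apply/eqP; ring.
by rewrite /= expR0 mul1r.
Qed.

Lemma circle_char0 t : circle_char 0 t = 1.
Proof. by rewrite /circle_char mulr0z mul0r cos0 sin0. Qed.

Lemma circle_charD k l t :
  circle_char (k + l) t = circle_char k t * circle_char l t.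
Proof.
apply/eqP; rewrite eq_complex /= rmorphD /= mulrDl cosD sinD.
by apply/andP; split; apply/eqP; ring.
Qed.

Lemma circle_char_sum (I : finType) (F : I -> int) t :
  circle_char (\sum_i F i) t = \prod_i circle_char (F i) t.
Proof.
exact: (big_morph (circle_char^~ t) (fun k l => circle_charD k l t)
  (circle_char0 t)).
Qed.

Lemma circle_charX k j t : circle_char k t ^+ j = circle_char (k * j%:Z) t.
Proof.
elim: j => [|j IHj]; first by rewrite expr0 mulr0 circle_char0.
by rewrite exprS IHj intS mulrDr mulr1 circle_charD.
Qed.

Lemma norm_circle_char k t : `|circle_char k t| = 1.
Proof. by rewrite normc_def /= cos2Dsin2 sqrtr1. Qed.

Lemma sin_intrpi k : sin (k%:~R * pi) = 0 :> R.
Proof.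
have nat_case (j : nat) : sin (j%:~R * pi) = 0 :> R.
  elim: j => [|j IHj]; first by rewrite mul0r sin0.
  by rewrite intS rmorphD /= mulrDl mul1r addrC sinDpi IHj oppr0.
case: (intP k) => [|j|j]; rewrite ?nat_case// ?mul0r ?sin0 //.
by rewrite rmorphN /= mulNr sinN nat_case oppr0.
Qed.

End CircleCharacter.

(** * Integrals of complex-valued functions *)

Section ComplexIntegral.
Variable R : realType.
Implicit Types (f g : R -> R[i]) (a b : R).

(** Continuity is required of the real and imaginary parts because [cintegral]
    is defined through them; integrability over segments then reduces to the
    real case. *)
Definition ccontinuous f :=
  continuous (fun t => complex.Re (f t)) /\
  continuous (fun t => complex.Im (f t)).

Lemma ccontinuous_cst (c : R[i]) : ccontinuous (fun=> c).
Proof. by split=> x; exact: cvg_cst. Qed.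

Lemma ccontinuousD f g : ccontinuous f -> ccontinuous g ->
  ccontinuous (fun t => f t + g t).
Proof.
move=> [f1 f2] [g1 g2]; split=> x.
- rewrite (_ : (fun t => complex.Re (f t + g t)) =
    (fun t => complex.Re (f t) + complex.Re (g t))); last first.
    by apply/funext => t; case: (f t); case: (g t).
  by apply: cvgD; [exact: f1|exact: g1].
- rewrite (_ : (fun t => complex.Im (f t + g t)) =
    (fun t => complex.Im (f t) + complex.Im (g t))); last first.
    by apply/funext => t; case: (f t); case: (g t).
  by apply: cvgD; [exact: f2|exact: g2].
Qed.

Lemma ccontinuousM f g : ccontinuous f -> ccontinuous g ->
  ccontinuous (fun t => f t * g t).
Proof.
move=> [f1 f2] [g1 g2]; split=> x.
- rewrite (_ : (fun t => complex.Re (f t * g t)) =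
    (fun t => complex.Re (f t) * complex.Re (g t) -
              complex.Im (f t) * complex.Im (g t))); last first.
    by apply/funext => t; case: (f t); case: (g t).
  apply: cvgB; apply: continuousM;
    by first [exact: f1|exact: f2|exact: g1|exact: g2].
- rewrite (_ : (fun t => complex.Im (f t * g t)) =
    (fun t => complex.Re (f t) * complex.Im (g t) +
              complex.Im (f t) * complex.Re (g t))); last first.
    by apply/funext => t; case: (f t); case: (g t).
  apply: cvgD; apply: continuousM;
    by first [exact: f1|exact: f2|exact: g1|exact: g2].
Qed.

(** The real and imaginary parts of an inverse are quotients by the squared
    modulus, which is continuous and vanishes nowhere. *)
Lemma ccontinuousV f : ccontinuous f -> (forall t, f t != 0) ->
  ccontinuous (fun t => (f t)^-1).
Proof.
move=> [f1 f2] f_neq0.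
pose d t := complex.Re (f t) * complex.Re (f t) +
            complex.Im (f t) * complex.Im (f t).
have d_neq0 t : d t != 0.
  move: (f_neq0 t); rewrite eq_complex /d; case: (f t) => x y /=.
  by rewrite -!expr2 paddr_eq0 ?sqr_ge0// !sqrf_eq0.
have dV x : {for x, continuous (fun t => (d t)^-1)}.
  apply: continuousV; first exact: d_neq0.
  apply: cvgD; apply: continuousM;
    by first [exact: f1|exact: f2].
split=> x.
- rewrite (_ : (fun t => complex.Re (f t)^-1) =
    (fun t => complex.Re (f t) * (d t)^-1)); last first.
    by apply/funext => t; rewrite /d; case: (f t).
  by apply: cvgM; [exact: f1|exact: dV].
- rewrite (_ : (fun t => complex.Im (f t)^-1) =
    (fun t => - (complex.Im (f t) * (d t)^-1))); last first.
    by apply/funext => t; rewrite /d; case: (f t).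
  by apply: cvgN; apply: cvgM; [exact: f2|exact: dV].
Qed.

Lemma ccontinuous_sum (I : Type) (s : seq I) (F : I -> R -> R[i]) :
  (forall i, ccontinuous (F i)) -> ccontinuous (fun t => \sum_(i <- s) F i t).
Proof.
move=> cF; elim: s => [|i s IHs].
  by under eq_fun do rewrite big_nil; exact: ccontinuous_cst.
by under eq_fun do rewrite big_cons; exact: ccontinuousD.
Qed.

Lemma ccontinuous_prod (I : Type) (s : seq I) (F : I -> R -> R[i]) :
  (forall i, ccontinuous (F i)) -> ccontinuous (fun t => \prod_(i <- s) F i t).
Proof.
move=> cF; elim: s => [|i s IHs].
  by under eq_fun do rewrite big_nil; exact: ccontinuous_cst.
by under eq_fun do rewrite big_cons; exact: ccontinuousM.
Qed.

Lemma ccontinuous_circle_char k : ccontinuous (@circle_char R k).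
Proof.
have scale x : {for x, continuous (fun t : R => k%:~R * t)}.
  by apply: continuousM => //; exact: cvg_cst.
split=> x; apply: (continuous_comp (scale x)).
- exact: continuous_cos.
- exact: continuous_sin.
Qed.

Lemma continuous_integrable_itv (h : R -> R) a b : continuous h ->
  (@lebesgue_measure R).-integrable
    `[a, b] (EFin \o h).
Proof.
move=> ch; apply: continuous_compact_integrable; first exact: segment_compact.
by apply: continuous_subspaceT.
Qed.

Lemma cintegralD a b f g : ccontinuous f -> ccontinuous g ->
  cintegral a b (fun t => f t + g t) = cintegral a b f + cintegral a b g.
Proof.
move=> [f1 f2] [g1 g2].
apply/eqP; rewrite eq_complex /=; apply/andP; split; apply/eqP.
- rewrite -RintegralD//; try exact: continuous_integrable_itv.
  by apply: eq_Rintegral => t _; case: (f t); case: (g t).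
- rewrite -RintegralD//; try exact: continuous_integrable_itv.
  by apply: eq_Rintegral => t _; case: (f t); case: (g t).
Qed.

Lemma cintegralZ a b (c : R[i]) f : ccontinuous f ->
  cintegral a b (fun t => c * f t) = c * cintegral a b f.
Proof.
case: c => u v [f1 f2].
have fi1 : (@lebesgue_measure R).-integrable
    `[a, b] (EFin \o (fun t => complex.Re (f t))).
  exact: continuous_integrable_itv.
have fi2 : (@lebesgue_measure R).-integrable
    `[a, b] (EFin \o (fun t => complex.Im (f t))).
  exact: continuous_integrable_itv.
have cM w (h : R -> R) : continuous h -> continuous (fun t => w * h t).
  by move=> ch x; apply: continuousM; [exact: cvg_cst|exact: ch].
apply/eqP; rewrite eq_complex /=; apply/andP; split; apply/eqP.
- rewrite -!RintegralZl// -RintegralB//;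
    try by apply: continuous_integrable_itv; exact: cM.
  by apply: eq_Rintegral => t _; case: (f t).
- rewrite -!RintegralZl// -RintegralD//;
    try by apply: continuous_integrable_itv; exact: cM.
  by apply: eq_Rintegral => t _; case: (f t).
Qed.

Lemma cintegral_cst a b (c : R[i]) : a <= b ->
  cintegral a b (fun=> c) = c * (b - a)%:C.
Proof.
case: c => u v ab; rewrite /cintegral !Rintegral_cst//=.
rewrite lebesgue_measure_itv /= lte_fin.
case: ltrgtP ab => // [ab _|-> _].
  by apply/eqP; rewrite eq_complex /= !mulr0 subr0 add0r !eqxx.
by rewrite subrr; apply/eqP; rewrite eq_complex /= !mulr0 subr0 add0r !eqxx.
Qed.

Lemma cintegral_sum a b (I : Type) (s : seq I) (F : I -> R -> R[i]) :
  (forall i, ccontinuous (F i)) ->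
  cintegral a b (fun t => \sum_(i <- s) F i t) =
  \sum_(i <- s) cintegral a b (F i).
Proof.
move=> cF; elim: s => [|i s IHs].
  rewrite big_nil -[RHS](mul0r (cintegral a b (fun=> 1))).
  rewrite -cintegralZ; last exact: ccontinuous_cst.
  by congr (cintegral a b); apply/funext => t; rewrite big_nil mul0r.
rewrite big_cons -IHs -cintegralD//; last exact: ccontinuous_sum.
by congr (cintegral a b); apply/funext => t; rewrite big_cons.
Qed.

Lemma normr_Rintegral_le (h : R -> R) (M a b : R) : a <= b ->
  continuous h -> (forall t, `|h t| <= M) ->
  `|\int[lebesgue_measure]_(t in `[a, b]) h t| <= M * (b - a).
Proof.
move=> ab ch hM.
apply: (le_trans (le_normr_Rintegral _ _)) => //.
  exact: continuous_integrable_itv.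
have -> : M * (b - a) = \int[lebesgue_measure]_(t in `[a, b]) (cst M t).
  have /(congr1 (@complex.Re R)) /= := cintegral_cst M%:C ab.
  by rewrite mulr0 subr0.
apply: le_Rintegral => //; apply: continuous_integrable_itv => x.
  by apply: cvg_norm; exact: ch.
exact: cvg_cst.
Qed.

Lemma norm_cintegral_le f (M a b : R) : a <= b -> ccontinuous f ->
  (forall t, `|f t| <= M%:C) ->
  `|complex.Re (cintegral a b f)| <= M * (b - a) /\
  `|complex.Im (cintegral a b f)| <= M * (b - a).
Proof.
move=> ab [f1 f2] fM; split; apply: normr_Rintegral_le => // t.
  by rewrite -lecR; apply: le_trans (fM t); exact: normc_ge_Re.
rewrite -lecR; apply: le_trans (fM t).
by rewrite normc_def lecR -sqrtr_sqr ler_wsqrtr// lerDr sqr_ge0.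
Qed.

(** For k <> 0 both parts have an antiderivative, sin (k t) / k and
    - cos (k t) / k, taking equal values at the two end points: the sine
    vanishes at integer multiples of pi and the cosine is even. *)
Lemma cintegral_circle_char k :
  cintegral (- pi) pi (@circle_char R k) = (k == 0)%:R * (2 * pi)%:C.
Proof.
have pipi : - pi < pi :> R by rewrite gtrN// pi_gt0.
case: eqVneq => [->|k_neq0]; last rewrite mul0r.
  rewrite (_ : @circle_char R 0 = fun=> 1); last first.
    by apply/funext => t; rewrite circle_char0.
  by rewrite cintegral_cst ?ltW// opprK mulrDl !mul1r.
have kR : k%:~R != 0 :> R by rewrite intr_eq0.
have scale x : is_derive (x : R) 1 (fun t : R => k%:~R * t) k%:~R.
  by apply: is_derive_eq; rewrite /GRing.scale /= mulr1.
have [ck sk] := ccontinuous_circle_char k.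
have ftc (h F : R -> R) : continuous h ->
    (forall x : R, is_derive x 1 F (h x)) -> F pi = F (- pi) ->
    \int[lebesgue_measure]_(t in `[- pi, pi]) h t = 0.
  move=> ch dF Fpi; rewrite /Rintegral.
  rewrite (@continuous_FTC2 _ h F (- pi) pi) ?Fpi ?subee//.
  - exact: continuous_subspaceT.
  - have cF : continuous F.
      move=> x; apply: differentiable_continuous; apply/derivable1_diffP.
      by have [] := dF x.
    split; first by move=> x _; have [] := dF x.
    + by apply: cvg_at_right_filter; exact: cF.
    + by apply: cvg_at_left_filter; exact: cF.
  - by move=> x _; rewrite derive1E; have [] := dF x.
apply/eqP; rewrite eq_complex /=; apply/andP; split; apply/eqP.
- apply: (ftc _ (fun t => k%:~R^-1 * sin (k%:~R * t))) => //.
  + move=> x.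
    have -> : cos (k%:~R * x) = k%:~R^-1 *: (cos (k%:~R * x) * k%:~R).
      by rewrite /GRing.scale /= mulrCA mulVf// mulr1.
    exact: (is_deriveZ _
      (is_derive1_comp (is_derive_sin (k%:~R * x)) (scale x))).
  + by rewrite mulrN sinN sin_intrpi oppr0.
- apply: (ftc _ (fun t => - k%:~R^-1 * cos (k%:~R * t))) => //.
  + move=> x.
    have -> : sin (k%:~R * x) = - k%:~R^-1 *: (- sin (k%:~R * x) * k%:~R).
      by rewrite /GRing.scale /= !mulNr mulrN opprK mulrCA mulVf// mulr1.
    exact: (is_deriveZ _
      (is_derive1_comp (is_derive_cos (k%:~R * x)) (scale x))).
  + by rewrite mulrN cosN.
Qed.

End ComplexIntegral.

(** * Counting solutions of the aggregated equation *)

Section Counting.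
Variables (n : nat) (alpha : 'rV[int]_n) (beta : int).

Definition knapsack_solutions : set 'cV[int]_n :=
  [set x | (forall j, 0 <= x j 0) /\ \sum_j alpha 0 j * x j 0 = beta].

Definition bounded_solutions (N : nat) : {set {ffun 'I_n -> 'I_N.+1}} :=
  [set f : {ffun 'I_n -> 'I_N.+1} |
    \sum_j alpha 0 j * (f j : nat)%:Z == beta]%SET.

Hypothesis alpha_gt0 : forall j, 0 < alpha 0 j.

(** As the coefficients are at least 1 and the other terms are nonnegative, an
    entry is at most its own term and hence at most the whole sum. *)
Lemma knapsack_entry_le (x : 'cV[int]_n) j :
  knapsack_solutions x -> x j 0 <= beta.
Proof.
move=> [x_ge0 <-]; rewrite (bigD1 j)//=.
apply: (@le_trans _ _ (alpha 0 j * x j 0)).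
  by rewrite ler_peMl// -gtz0_ge1.
by rewrite lerDl sumr_ge0// => i _; rewrite mulr_ge0// ltW.
Qed.

(** The bound on the entries identifies the solutions with functions into
    {0, ..., N}, that is, with the exponent choices that occur when the
    truncated generating function is expanded. *)
Lemma knapsack_solutionsE N : (`|beta| <= N)%N ->
  knapsack_solutions =
  [set` [fset (\col_j (f j : nat)%:Z)%R |
    f : {ffun 'I_n -> 'I_N.+1} in bounded_solutions N]%fset].
Proof.
move=> betaN; apply/seteqP; split=> [x xS|x] /=.
- have [x_ge0 sumx] := xS.
  have xN j : (`|x j 0%R| < N.+1)%N.
    by have := knapsack_entry_le j xS; have := x_ge0 j; lia.
  apply/imfsetP; exists [ffun j => Ordinal (xN j)] => /=.
    rewrite inE -sumx; apply/eqP/eq_bigr => j _.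
    by rewrite ffunE /= gez0_abs.
  by apply/colP => j; rewrite !mxE ffunE /= gez0_abs.
- move=> /imfsetP[f /=]; rewrite inE => /eqP sumf ->.
  split=> [j|]; first by rewrite mxE.
  by rewrite -sumf; apply: eq_bigr => j _; rewrite mxE.
Qed.

Lemma finite_knapsack_solutions : finite_set knapsack_solutions.
Proof. by rewrite (knapsack_solutionsE (leqnn _)); exact: finite_fset. Qed.

Lemma card_knapsack_solutions N : (`|beta| <= N)%N ->
  #|` fset_set knapsack_solutions|%fset = #|bounded_solutions N|.
Proof.
move=> betaN; rewrite (knapsack_solutionsE betaN) set_fsetK card_imfset /=.
  by rewrite -cardE.
move=> f g /colP fg; apply/ffunP => j; apply/val_inj.
by have := fg j; rewrite !mxE => -[].
Qed.

End Counting.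

(** The aggregated system is a single rational equation between integers, so
    it can be read over the integers. *)
Lemma solutions_knapsackE (m n : nat) (A : 'M[int]_(m, n)) (b : 'cV[int]_m)
    (T : 'rV[rat]_m) (alpha : 'rV[int]_n) (beta : int) :
  strong_aggregation T A b ->
  map_mx intr alpha = T *m map_mx intr A ->
  beta%:~R = (T *m map_mx intr b) 0 0 ->
  solutions A b = knapsack_solutions alpha beta.
Proof.
move=> -> alphaE betaE.
rewrite /aggregated_solutions /knapsack_solutions -alphaE.
apply/seteqP; split=> x /= [x_ge0 sumx]; split => //.
- apply: (@intr_inj rat); rewrite betaE -sumx mxE rmorph_sum /=.
  by apply: eq_bigr => j _; rewrite !mxE rmorphM.
- apply/matrixP => i j; rewrite !ord1 -betaE -sumx mxE rmorph_sum /=.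
  by apply: eq_bigr => k _; rewrite !mxE rmorphM.
Qed.

(** * Estimates for products and geometric sums *)

Section ProductBounds.
Variable K : numFieldType.

Lemma norm_prod_one_sub_le (I : Type) (s : seq I) (w : I -> K) (eps : K) :
  eps <= 1 -> (forall i, `|w i| <= eps) ->
  `|\prod_(i <- s) (1 - w i)| <= 2 ^+ size s.
Proof.
move=> eps1 weps; elim: s => [|i s IHs]; first by rewrite big_nil normr1.
rewrite big_cons exprS normrM ler_pM//.
apply: le_trans (ler_normB _ _) _; rewrite normr1 -[2]/(1 + 1 : K).
by rewrite lerD2l (le_trans (weps i)).
Qed.

(** Splitting off one factor, 1 - (1 - w) P = (1 - P) + w P, adds at most
    eps |P| <= eps 2 ^ (size s) to the error; these increments sum to
    (2 ^ (size s) - 1) eps. *)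
Lemma norm_one_sub_prod_le (I : Type) (s : seq I) (w : I -> K) (eps : K) :
  0 <= eps -> eps <= 1 -> (forall i, `|w i| <= eps) ->
  `|1 - \prod_(i <- s) (1 - w i)| <= (2 ^+ size s - 1) * eps.
Proof.
move=> eps0 eps1 weps; elim: s => [|i s IHs].
  by rewrite big_nil /= expr0 !subrr normr0 mul0r.
rewrite big_cons /=; set P := \prod_(_ <- s) _ in IHs *.
have -> : 1 - (1 - w i) * P = (1 - P) + w i * P by ring.
apply: le_trans (ler_normD _ _) _.
have -> : (2 ^+ (size s).+1 - 1) * eps =
    (2 ^+ size s - 1) * eps + eps * 2 ^+ size s by rewrite exprS; ring.
by rewrite lerD// normrM ler_pM// (norm_prod_one_sub_le _ eps1).
Qed.

Lemma norm_inv_one_sub_le (q : K) : `|q| <= 2^-1 -> `|(1 - q)^-1| <= 2.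
Proof.
move=> q_le; have half_gt0 : 0 < 2^-1 :> K by rewrite invr_gt0.
have lb : 2^-1 <= `|1 - q|.
  apply: le_trans (lerB_dist _ _); rewrite normr1 lerBrDr.
  by rewrite {2}(splitr 1) mul1r lerD2l.
by rewrite normfV -[2]invrK lef_pV2// posrE (lt_le_trans half_gt0).
Qed.

Lemma sum_geometric (q : K) N : q != 1 ->
  \sum_(k < N) q ^+ k = (1 - q)^-1 * (1 - q ^+ N).
Proof.
move=> q1; have q1' : 1 - q != 0 by rewrite subr_eq0 eq_sym.
have -> : 1 - q ^+ N = (1 - q) * \sum_(k < N) q ^+ k.
  by rewrite -[LHS]opprB subrX1 -mulNr opprB.
by rewrite mulKf.
Qed.

End ProductBounds.

(** This turns the estimates valid for every truncation order into an exact
    equality. *)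
Lemma geometric_bound_eq0 (R : realType) (x M : R) (N0 : nat) :
  (forall N, (N0 <= N)%N -> `|x| <= M / 2 ^+ N) -> x = 0.
Proof.
move=> xM; apply/eqP; rewrite -normr_eq0; apply: contraT => x_neq0.
have x_gt0 : 0 < `|x| by rewrite lt_def x_neq0 normr_ge0.
pose N := maxn N0 (Num.truncn (M / `|x|)).+1.
have := xM N (leq_maxl _ _).
rewrite ler_pdivlMr ?exprn_gt0// mulrC -ler_pdivlMr// leNgt => /negP[].
apply: (lt_le_trans (truncnS_gt _)).
rewrite -natrX ler_nat (leq_trans (leq_maxr N0 _))// ltnW//.
exact: ltn_expl.
Qed.

(** * Extracting the coefficient of the generating function *)

Section Coefficients.
Variables (R : realType) (n : nat) (alpha : 'rV[int]_n) (beta : int).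
Hypothesis alpha_gt0 : forall j, 0 < alpha 0 j.

(** With z = e^(i t) / 2, this is z^alpha_j. *)
Let q j (t : R) : R[i] := circle_char (alpha 0 j) t / 2 ^ alpha 0 j.

Let two_neq0 : 2 != 0 :> R[i]. Proof. by rewrite pnatr_eq0. Qed.

Let norm_q_le j t : `|q j t| <= 2^-1.
Proof.
rewrite /q normrM norm_circle_char mul1r normfV ger0_norm ?exprz_ge0//.
rewrite lef_pV2 ?posrE ?exprz_gt0//.
case: (alpha 0 j) (alpha_gt0 j) => [[|k]|]// _.
by rewrite -exprnP exprS ler_peMr// exprn_ege1// ler1n.
Qed.

Let q_neq1 j t : q j t != 1.
Proof.
apply: contraTneq (norm_q_le j t) => ->.
by rewrite normr1 lt_geF// invf_lt1 ?ltr1n.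
Qed.

Let ccontinuous_q j : ccontinuous (q j).
Proof.
by apply: ccontinuousM; [exact: ccontinuous_circle_char|exact: ccontinuous_cst].
Qed.

Let ccontinuous_qX j k : ccontinuous (fun t => q j t ^+ k).
Proof.
elim: k => [|k IHk]; first exact: ccontinuous_cst.
by under eq_fun do rewrite exprS; exact: ccontinuousM.
Qed.

(** Every geometric series of the generating function is cut after its
    [N]-th power. *)
Definition truncated_integrand (N : nat) (t : R) : R[i] :=
  (\prod_j \sum_(k < N.+1) q j t ^+ k) * circle_char (- beta) t.

Definition full_integrand (t : R) : R[i] :=
  (\prod_j (1 - q j t)^-1) * circle_char (- beta) t.

Lemma ccontinuous_truncated N : ccontinuous (truncated_integrand N).
Proof.
apply: ccontinuousM; last exact: ccontinuous_circle_char.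
by apply: ccontinuous_prod => j; apply: ccontinuous_sum => k.
Qed.

Lemma ccontinuous_full : ccontinuous full_integrand.
Proof.
apply: ccontinuousM; last exact: ccontinuous_circle_char.
apply: ccontinuous_prod => j; apply: ccontinuousV => [|t].
  rewrite (_ : (fun t => 1 - q j t) = fun t => 1 + -1 * q j t).
    apply: ccontinuousD; first exact: ccontinuous_cst.
    by apply: ccontinuousM; [exact: ccontinuous_cst|].
  by apply/funext => t; rewrite mulN1r.
by rewrite subr_eq0 eq_sym.
Qed.

(** Distributing the product over the sums chooses one exponent [f j] in each
    factor, and the modulus and the argument of the resulting monomial depend
    on [f] only through the value of the linear form. *)
Lemma truncated_integrandE N t : truncated_integrand N t =
  \sum_(f : {ffun 'I_n -> 'I_N.+1})
    (2 ^ (- \sum_j alpha 0 j * (f j : nat)%:Z)) *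
    circle_char (\sum_j alpha 0 j * (f j : nat)%:Z - beta) t.
Proof.
rewrite /truncated_integrand bigA_distr_bigA mulr_suml; apply: eq_bigr => f _.
rewrite circle_charD mulrA; congr (_ * _).
rewrite circle_char_sum -sumrN.
rewrite (big_morph (fun k : int => 2 ^ k : R[i])
  (fun k l => expfzDr k l two_neq0) (expr0z 2)) -big_split /=.
apply: eq_bigr => j _.
by rewrite expr_div_n circle_charX mulrC exprnP exprz_exp invr_expz.
Qed.

(** By orthogonality only the monomials of frequency 0 survive, and those are
    the [f] that solve the equation, all with the same weight 2 ^ (- beta). *)
Lemma cintegral_truncated N : cintegral (- pi) pi (truncated_integrand N) =
  2 ^ (- beta) * (2 * pi)%:C * #|bounded_solutions alpha beta N|%:R.
Proof.
pose c (f : {ffun 'I_n -> 'I_N.+1}) := \sum_j alpha 0 j * (f j : nat)%:Z.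
have -> : truncated_integrand N =
    fun t => \sum_f 2 ^ (- c f) * circle_char (c f - beta) t.
  by apply/funext; exact: truncated_integrandE.
rewrite cintegral_sum => [|f]; last first.
  apply: ccontinuousM; first exact: ccontinuous_cst.
  exact: ccontinuous_circle_char.
under eq_bigr => f _.
  rewrite cintegralZ; last exact: ccontinuous_circle_char.
  rewrite cintegral_circle_char subr_eq0 mulrCA.
  over.
rewrite (eq_bigr (fun f : {ffun 'I_n -> 'I_N.+1} =>
  if f \in bounded_solutions alpha beta N
  then 2 ^ (- beta) * (2 * pi)%:C else 0)).
  by rewrite -big_mkcond /= sumr_const mulr_natr.
move=> f _; rewrite inE; case: eqP => [->|_]; first by rewrite mul1r.
by rewrite mul0r.
Qed.

(** A truncated factor is (1 - q^(N + 1)) / (1 - q), so the difference is the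
    full product times 1 - prod_j (1 - q_j^(N + 1)).  Each 1 / (1 - q_j) is at
    most 2 in modulus because |q_j| <= 1 / 2, whence the constant 2 ^ n. *)
Lemma norm_full_sub_truncated_le N t :
  `|full_integrand t - truncated_integrand N t| <=
  (2 ^+ n * (2 ^+ n - 1) / 2 ^+ N)%:C.
Proof.
set E := \prod_j (1 - q j t)^-1.
have -> : full_integrand t - truncated_integrand N t =
    E * (1 - \prod_j (1 - q j t ^+ N.+1)) * circle_char (- beta) t.
  rewrite /full_integrand /truncated_integrand -/E.
  rewrite (eq_bigr (fun j => (1 - q j t)^-1 * (1 - q j t ^+ N.+1))).
    by rewrite big_split /= -/E mulrBr mulr1 mulrBl.
  by move=> j _; rewrite sum_geometric.
have sizeE : size (index_enum 'I_n) = n.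
  by rewrite -[RHS]card_ord cardT enumT.
rewrite !normrM norm_circle_char mulr1 -mulrA rmorphM rmorphXn /=.
apply: ler_pM => //.
  rewrite normr_prod.
  apply: (@le_trans _ _ (\prod_(j < n) 2)).
    apply: ler_prod => j _; rewrite normr_ge0 /=.
    by rewrite norm_inv_one_sub_le.
  by rewrite prodr_const card_ord rmorph_nat.
have -> : ((2 ^+ n - 1) / 2 ^+ N)%:C = (2 ^+ n - 1) * 2^-1 ^+ N :> R[i].
  rewrite rmorphM rmorphB rmorphXn fmorphV rmorphXn rmorph1 rmorph_nat.
  by rewrite exprVn.
rewrite -[X in 2 ^+ X - 1]sizeE; apply: norm_one_sub_prod_le.
- by rewrite exprn_ge0// invr_ge0.
- by rewrite exprn_ile1 ?invr_ge0// invf_le1 ?ler1n.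
move=> j; rewrite normrX exprS.
apply: (@le_trans _ _ (1 * 2^-1 ^+ N)); last by rewrite mul1r.
rewrite ler_pM ?exprn_ge0//.
  by apply: le_trans (norm_q_le j t) _; rewrite invf_le1 ?ler1n.
by rewrite lerXn2r ?nnegrE// invr_ge0.
Qed.

(** The difference of the two sides does not depend on [N], while the
    truncation of order [N] bounds it by a constant times 2 ^ (- N) as soon as
    [N] is at least |beta|. *)
Lemma cintegral_full : cintegral (- pi) pi full_integrand =
  2 ^ (- beta) * (2 * pi)%:C *
  (#|` fset_set (knapsack_solutions alpha beta)|%fset)%:R.
Proof.
apply/eqP; rewrite -subr_eq0; set D := _ - _.
have pipi : - pi <= pi :> R by rewrite ge0_cp ?pi_ge0.
pose M : R := 2 ^+ n * (2 ^+ n - 1) * (pi - - pi).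
have D_le N : (`|beta| <= N)%N ->
    `|complex.Re D| <= M / 2 ^+ N /\ `|complex.Im D| <= M / 2 ^+ N.
  move=> betaN.
  have cG : ccontinuous (truncated_integrand N) by exact: ccontinuous_truncated.
  have cNG : ccontinuous (fun t => -1 * truncated_integrand N t).
    by apply: ccontinuousM; first exact: ccontinuous_cst.
  have -> : D = cintegral (- pi) pi
      (fun t => full_integrand t + -1 * truncated_integrand N t).
    rewrite cintegralD//; last exact: ccontinuous_full.
    rewrite cintegralZ// cintegral_truncated mulN1r.
    by rewrite /D (card_knapsack_solutions alpha_gt0 betaN).
  have -> : M / 2 ^+ N = 2 ^+ n * (2 ^+ n - 1) / 2 ^+ N * (pi - - pi).
    by rewrite /M mulrAC.
  apply: norm_cintegral_le => // [|t].
    by apply: ccontinuousD; first exact: ccontinuous_full.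
  by rewrite mulN1r; exact: norm_full_sub_truncated_le.
rewrite eq_complex; apply/andP; split; apply/eqP.
- by apply: (geometric_bound_eq0 (M := M) (N0 := `|beta|%N)) => N /D_le[].
- by apply: (geometric_bound_eq0 (M := M) (N0 := `|beta|%N)) => N /D_le[].
Qed.

End Coefficients.

(** * The counting formula *)

Theorem proposition7 (R : realType) (m n : nat)
    (A : 'M[int]_(m, n)) (b : 'cV[int]_m)
    (rankA : \rank (map_mx intr A : 'M[rat]_(m, n)) = m)
    (pointedA : pointed (cone R A))
    (T : 'rV[rat]_m)
    (strongT : strong_aggregation T A b)
    (alpha : 'rV[int]_n) (beta : int)
    (alphaE : map_mx intr alpha = T *m map_mx intr A)
    (betaE : beta%:~R = (T *m map_mx intr b) 0 0)
    (alpha_gt0 : forall j, 0 < alpha 0 j) :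
  finite_set (solutions A b) /\
  (#|` fset_set (solutions A b)|%fset)%:R =
    2 ^ (beta - 1) / pi%:C *
    cintegral (- pi) pi (fun theta : R =>
      (\prod_(j < n) (2 ^ alpha 0 j /
        (2 ^ alpha 0 j - cexp ('i%C * (alpha 0 j)%:~R * theta%:C))))
      * cexp (- 'i%C * beta%:~R * theta%:C)) :> R[i].
Proof.
rewrite (solutions_knapsackE strongT alphaE betaE).
split; first exact: finite_knapsack_solutions.
have pow2_neq0 (k : int) : 2 ^ k != 0 :> R[i] by rewrite expfz_neq0 ?pnatr_eq0.
have pi_neq0 : pi%:C != 0 :> R[i].
  by rewrite (inj_eq (@complexI R)) gt_eqF ?pi_gt0.
(* Dividing numerator and denominator by 2 ^ alpha_j turns each factor into
   1 / (1 - q_j). *)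
rewrite (_ : (fun theta => _) = full_integrand alpha beta); last first.
  apply/funext => t; rewrite /full_integrand; congr (_ * _).
    apply: eq_bigr => j _; rewrite cexp_circle_char.
    set u := 2 ^ alpha 0 j; have u_neq0 : u != 0 by exact: pow2_neq0.
    have -> : 1 - circle_char (alpha 0 j) t / u =
        (u - circle_char (alpha 0 j) t) / u by rewrite mulrBl divff.
    by rewrite invf_div.
  by rewrite -cexp_circle_char mulNr -mulrN -rmorphN.
rewrite cintegral_full//.
have -> : (2 * pi)%:C = 2 * pi%:C :> R[i] by rewrite rmorphM rmorph_nat.
rewrite expfzDr ?pnatr_eq0// -invr_expz exprN1.
move: pi%:C pi_neq0 (2 ^ beta) (pow2_neq0 beta) => p p_neq0 x x_neq0.
by field; rewrite x_neq0 p_neq0.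
Qed.
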